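(* Let $p$ be a prime and let $e\geq 2$ and $d\geq 3$ be integers. Let $\mathcal P(p^e,d)\subset\mathbb R^d$ be the convex hull of all $d$-dimensional vector-factorisations of $p^e$. Then the set of all facets of $\mathcal P(p^e,d)$ is exactly the set of convex hulls of the following finite sets: (1) $\{(p^e,1,\dots,1),(1,p^e,1,\dots,1),\dots,(1,\dots,1,p^e)\}$; (2) for each $i=1,\dots,d$, the set $\{(p^{\beta_1},\dots,p^{\beta_d})\ :\ (\beta_1,\dots,\beta_d)\in\mathbb N^d,\ \beta_i=0,\ \sum_{j=1}^d\beta_j=e\}$; (3) for each $\lambda\in\{1,\dots,\min(e,d-1)\}$ and each $d$-dimensional vector-factorisation $(p^{\beta_1},\dots,p^{\beta_d})$ of $p^{e-\lambda}$, the set $\{(p^{\beta_1+\epsilon_1},\dots,p^{\beta_d+\epsilon_d})\ :\ (\epsilon_1,\dots,\epsilon_d)\in\{0,1\}^d,\ \sum_{i=1}^d\epsilon_i=\lambda\}$.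
   Context: $\mathbb N=\{0,1,2,\dots\}$. A $d$-dimensional vector-factorisation of an integer $N\geq1$ is an integral vector $(v_1,\dots,v_d)\in\mathbb N^d$ with $v_1v_2\cdots v_d=N$. A facet of a $d$-dimensional polytope is a face of dimension $d-1$. *)

(* Defs.v *)
From HB Require Import structures.
From mathcomp Require Import all_boot all_order all_algebra.
From mathcomp Require Import reals.
Set Implicit Arguments. Unset Strict Implicit. Unset Printing Implicit Defensive.
Import Order.TTheory GRing.Theory Num.Theory.
Local Open Scope ring_scope.

Section Polytopes.
Variables (R : realType) (d : nat).

Definition rset := 'rV[R]_d -> Prop.

Definition dotv (a x : 'rV[R]_d) : R := \sum_(i < d) a 0 i * x 0 i.

Definition conv (A : rset) : rset := fun x =>
  exists (n : nat) (v : 'I_n -> 'rV[R]_d) (w : 'I_n -> R),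
    (forall i, A (v i)) /\ (forall i, 0 <= w i) /\
    \sum_(i < n) w i = 1 /\ x = \sum_(i < n) w i *: v i.

Definition aff_indep (n : nat) (v : 'I_n -> 'rV[R]_d) : Prop :=
  forall c : 'I_n -> R,
    \sum_(i < n) c i = 0 -> \sum_(i < n) c i *: v i = 0 -> forall i, c i = 0.

Definition has_affdim (S : rset) (k : nat) : Prop :=
  (exists v : 'I_k.+1 -> 'rV[R]_d, (forall i, S (v i)) /\ aff_indep v) /\
  (forall (n : nat) (v : 'I_n -> 'rV[R]_d),
      (forall i, S (v i)) -> aff_indep v -> (n <= k.+1)%N).

Definition is_face (P F : rset) : Prop :=
  exists (a : 'rV[R]_d) (b : R),
    (forall x, P x -> dotv a x <= b) /\
    F = (fun x => P x /\ dotv a x = b).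

Definition is_facet (P F : rset) : Prop :=
  is_face P F /\ exists k : nat, has_affdim P k.+1 /\ has_affdim F k.

Definition vfact (N : nat) : rset := fun x =>
  exists v : 'I_d -> nat, (\prod_(i < d) v i)%N = N /\ x = \row_i (v i)%:R.

End Polytopes.

(* Main.v *)
Require Import Defs.
From HB Require Import structures.
From mathcomp Require Import all_boot all_order all_algebra.
From mathcomp Require Import boolp reals.
From mathcomp Require Import lra zify.
Set Implicit Arguments. Unset Strict Implicit. Unset Printing Implicit Defensive.
Import Order.TTheory GRing.Theory Num.Theory.
Local Open Scope ring_scope.

(** Write q = p. The factorisations of p^e are the points (q^g_1, ..., q^g_d)
    with g_1 + ... + g_d = e. Facets correspond to nonzero functionals a which
    are determined up to scaling by being constant on their set V of maximisers.
    Comparing a maximiser g with g + e_i - e_j (when g_j > 0, i <> j) gives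
    a_i q^g_i <= a_j q^(g_j - 1). From this:
    - if all a_i > 0, maximisers have a single nonzero exponent: case (1);
    - if some a_i > 0 >= a_j, then g_j = 0 on V, which forces a to be
      proportional to the j-th coordinate, a contradiction;
    - if all a_i <= 0 and some a_k = 0 > a_i, then g_i = 0 on V: case (2);
    - if all a_i < 0, two maximisers differ by at most 1 in each exponent, so V
      lies in a cube beta + {0,1}^d, where x |-> sum_i x_i / q^beta_i is
      constant; hence a_i is proportional to -1 / q^beta_i: case (3).
    Conversely the three functionals 1, -e_i and -(1 / q^beta_i)_i have exactly
    the listed sets of maximisers. *)

(** * Convex hulls and linear functionals *)

Section Polytope.
Variables (R : realType) (d : nat).
Implicit Types (A S : rset R d) (a x : 'rV[R]_d).

Lemma dotv_sum a n (w : 'I_n -> R) (v : 'I_n -> 'rV[R]_d) :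
  dotv a (\sum_(i < n) w i *: v i) = \sum_(i < n) w i * dotv a (v i).
Proof.
rewrite /dotv.
under eq_bigr => j _ do rewrite summxE mulr_sumr.
rewrite exchange_big; apply: eq_bigr => i _; rewrite mulr_sumr.
by apply: eq_bigr => j _; rewrite mxE mulrCA.
Qed.

Lemma dotvZ (t : R) a x : dotv (t *: a) x = t * dotv a x.
Proof.
by rewrite /dotv mulr_sumr; apply: eq_bigr => i _; rewrite mxE mulrA.
Qed.

Lemma dot0v x : dotv 0 x = 0.
Proof. by rewrite /dotv big1 // => i _; rewrite mxE mul0r. Qed.

Lemma dotv_delta i x : dotv (delta_mx 0 i) x = x 0 i.
Proof.
rewrite /dotv (bigD1 i) //= big1 ?addr0; first by rewrite mxE !eqxx mul1r.
by move=> j /negPf ji; rewrite mxE ji andbF mul0r.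
Qed.

Lemma conv_sub A x : A x -> conv A x.
Proof.
move=> Ax; exists 1%N, (fun=> x), (fun=> 1); split=> //; split=> //.
by rewrite !big_ord_recl !big_ord0 scale1r !addr0.
Qed.

Lemma conv_dotv_eq A a (b : R) : (forall x, A x -> dotv a x = b) ->
  forall x, conv A x -> dotv a x = b.
Proof.
move=> Ab x [n [v [w [Av [_ [w1 ->]]]]]]; rewrite dotv_sum.
by under eq_bigr => i _ do rewrite Ab //; rewrite -mulr_suml w1 mul1r.
Qed.

Lemma conv_dotv_le A a (b : R) : (forall x, A x -> dotv a x <= b) ->
  forall x, conv A x -> dotv a x <= b.
Proof.
move=> Ab x [n [v [w [Av [w0 [w1 ->]]]]]]; rewrite dotv_sum -[b]mul1r -w1.
by rewrite mulr_suml; apply: ler_sum => i _; apply: ler_wpM2l => //; apply: Ab.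
Qed.

Lemma conv_nonempty A x : conv A x -> exists y, A y.
Proof.
case=> -[|n] [v [w [Av [_ [w1 _]]]]]; last by exists (v ord0).
by move: w1; rewrite big_ord0 => /esym/eqP; rewrite oner_eq0.
Qed.

(** The gaps [b - dotv a (v i)] are nonnegative and their weighted sum is zero, so every point of
    nonzero weight attains the bound. *)
Lemma conv_face A a (b : R) : (forall x, A x -> dotv a x <= b) ->
  (fun x => conv A x /\ dotv a x = b) = conv (fun x => A x /\ dotv a x = b).
Proof.
move=> Ab; apply/predeqP => x; split; last first.
  move=> cx; split; last by apply: conv_dotv_eq cx => y [].
  case: cx => n [v [w [Av ?]]]; exists n, v, w; split=> // i.
  by have [] := Av i.
move=> [[n [v [w [Av [w0 [w1 ->]]]]]]].
rewrite dotv_sum => /eqP; rewrite -subr_eq0 -{1}[b]mul1r -{1}w1 mulr_suml -sumrB.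
rewrite -oppr_eq0 -sumrN => /eqP gap0.
have slack i : w i * (b - dotv a (v i)) = 0.
  rewrite -[RHS](psumr_eq0P _ gap0 (i := i)) //; first by rewrite mulrBr opprB.
  by move=> j _; rewrite opprB -mulrBr mulr_ge0 // subr_ge0 Ab.
have [i0 wi0] : exists i, w i != 0.
  apply: contrapT => nw; move: w1; rewrite big1 => [/esym/eqP|i _].
    by rewrite oner_eq0.
  by apply/eqP; apply: contrapT => /negP wi; apply: nw; exists i.
have tight i : w i != 0 -> dotv a (v i) = b.
  move=> wi; have /eqP := slack i; rewrite mulf_eq0 (negPf wi) subr_eq0 /=.
  by move=> /eqP.
(* Points of weight zero may miss the bound; replacing them by [v i0] does not change the sum. *)
exists n, (fun i => if w i == 0 then v i0 else v i), w; split.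
  move=> i; case: eqP => [_|/eqP wi]; first by split=> //; exact: tight.
  by split=> //; exact: tight.
do 2!split=> //; apply: eq_bigr => i _.
by case: eqP => // ->; rewrite !scale0r.
Qed.

(** * Affine independence as linear independence of the rows [(1, v i)] *)

Definition homog n (v : 'I_n -> 'rV[R]_d) : 'M[R]_(n, 1 + d) :=
  row_mx (const_mx 1) (\matrix_i v i).

Lemma mul_homog n (v : 'I_n -> 'rV[R]_d) (c : 'rV[R]_n) :
  c *m homog v = row_mx (\sum_i c 0 i)%:M (\sum_i c 0 i *: v i).
Proof.
rewrite /homog mul_mx_row; congr row_mx.
  apply/matrixP => i j; rewrite !ord1 !mxE mulr1n.
  by apply: eq_bigr => k _; rewrite mxE mulr1.
by rewrite mulmx_sum_row; apply: eq_bigr => k _; rewrite rowK.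
Qed.

Lemma aff_indep_homog n (v : 'I_n -> 'rV[R]_d) :
  aff_indep v <-> row_free (homog v).
Proof.
split=> [ind|free c c0 cv].
  apply: inj_row_free => c; rewrite mul_homog -[0 in RHS]row_mx0.
  move=> /eq_row_mx [c0 cv]; apply/rowP => i; rewrite [RHS]mxE.
  apply: ind cv i.
  by move/matrixP/(_ 0 0): c0; rewrite !mxE mulr1n.
have : (\row_i c i) *m homog v == 0.
  rewrite mul_homog.
  under eq_bigr => i _ do rewrite mxE.
  under [X in row_mx _ X]eq_bigr => i _ do rewrite mxE.
  by rewrite c0 cv raddf0 row_mx0.
rewrite (mulmx_free_eq0 _ free) => /eqP/rowP e0 i.
by have := e0 i; rewrite !mxE.
Qed.

(* The hyperplane a . x = b in homogeneous coordinates (1, x). *)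
Definition hyperp (b : R) a : 'rV[R]_(1 + d) := row_mx (- b)%:M a.

Lemma homog_hyperp n (v : 'I_n -> 'rV[R]_d) (b : R) a :
  (forall i, dotv a (v i) = b) <-> (hyperp b a <= kermx (homog v)^T)%MS.
Proof.
have E i : (hyperp b a *m (homog v)^T) 0 i = dotv a (v i) - b.
  rewrite /homog tr_row_mx mul_row_col mxE addrC; congr +%R.
    by rewrite mxE; apply: eq_bigr => j _; rewrite !mxE.
  by rewrite mul_scalar_mx !mxE mulr1.
split=> [vb|/sub_kermxP e0 i].
  by apply/sub_kermxP/rowP => i; rewrite E vb subrr mxE.
by apply/eqP; rewrite -subr_eq0 -E e0 mxE.
Qed.

Lemma rank_hyperp (b : R) a : a != 0 -> \rank (hyperp b a) = 1%N.
Proof.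
move=> a0; rewrite rank_rV; case: eqP => // /eqP.
by rewrite row_mx_eq0 (negPf a0) andbF.
Qed.

Lemma aff_indep_size n (v : 'I_n -> 'rV[R]_d) : aff_indep v -> (n <= d.+1)%N.
Proof.
move=> /aff_indep_homog free; rewrite -(eqP free); exact: rank_leq_col.
Qed.

Lemma aff_indep_size_hyperp n (v : 'I_n -> 'rV[R]_d) a (b : R) : a != 0 ->
  (forall i, dotv a (v i) = b) -> aff_indep v -> (n <= d)%N.
Proof.
move=> a0 /homog_hyperp/mxrankS; rewrite rank_hyperp // mxrank_ker mxrank_tr.
by move=> rk /aff_indep_homog /eqP free; move: rk; rewrite free add1n subn_gt0 ltnS.
Qed.

(** Here [homog v] has rank [d] and [d.+1] columns, so the hyperplanes through all the [v i] form a
    one-dimensional kernel. *)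
Lemma hyperp_unique (v : 'I_d -> 'rV[R]_d) a (b : R) a' (b' : R) :
  aff_indep v -> a != 0 -> (forall i, dotv a (v i) = b) ->
  (forall i, dotv a' (v i) = b') -> exists t, a' = t *: a.
Proof.
move=> /aff_indep_homog /eqP free a0 /homog_hyperp va /homog_hyperp va'.
have ker1 : \rank (kermx (homog v)^T) = 1%N.
  by rewrite mxrank_ker mxrank_tr free addnK.
have := mxrank_leqif_sup va; rewrite rank_hyperp // ker1 => -[_ /esym].
rewrite eqxx => /(submx_trans va') /sub_rVP [t].
rewrite /hyperp scale_row_mx => /eq_row_mx [_ ->].
by exists t.
Qed.

(** Dual form of spanning: when [a] is nonzero and constant on [A], the affine hull of [A] is a
    hyperplane with normal [a]. The value [a = 0] is allowed on purpose and expresses that [A] is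
    full-dimensional. *)
Definition spans_hyperplane A a : Prop := forall a' (b' : R),
  (forall x, A x -> dotv a' x = b') -> exists t, a' = t *: a.

(** The kernel of the transpose of [homog v] has dimension at most [(a != 0)], so rank-nullity
    leaves [d.+1 - (a != 0)] independent rows. *)
Lemma spanning_family_aff_indep n (v : 'I_n.+1 -> 'rV[R]_d) a (b : R) :
  (forall i, dotv a (v i) = b) ->
  (forall a' (b' : R), (forall i, dotv a' (v i) = b') -> exists t, a' = t *: a) ->
  exists f : 'I_(d.+1 - (a != 0)) -> 'I_n.+1, aff_indep (fun i => v (f i)).
Proof.
move=> vb span; set m := (_ - _)%N.
(* A kernel row reads back as a hyperplane [hyperp b' a'] through all the points, hence is a
   multiple of [hyperp b a], and is zero if [a = 0]. *)
have ker_le : (kermx (homog v)^T <= (if a == 0 then 0 else hyperp b a))%MS.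
  apply/row_subP => i; set r := row i _.
  pose b' := - r 0 (lshift d 0); pose a' : 'rV_d := rsubmx (r : 'rV_(1 + d)).
  have re : r = hyperp b' a'.
    rewrite -[LHS](@hsubmxK _ 1 1 d r); congr row_mx.
    apply/matrixP => j k; by rewrite !ord1 [LHS]mxE [RHS]mxE /b' opprK mulr1n.
  have vb' : forall j, dotv a' (v j) = b'.
    by apply/homog_hyperp; rewrite -re row_sub.
  have [t at'] := span _ _ vb'.
  have bt : b' = t * b by rewrite -(vb' ord0) at' dotvZ vb.
  rewrite re; case: eqP => [a0|_].
    have -> : b' = 0 by rewrite -(vb' ord0) at' a0 scaler0 dot0v.
    by rewrite /hyperp at' a0 scaler0 oppr0 raddf0 row_mx0 sub0mx.
  apply/sub_rVP; exists t; rewrite /hyperp scale_row_mx -at' bt.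
  by rewrite -mulrN scale_scalar_mx.
have rk : (m <= \rank (homog v))%N.
  have := mxrankS ker_le; rewrite mxrank_ker mxrank_tr /m; set r := \rank (homog v).
  case: eqP => [_|/eqP a0]; rewrite ?mxrank0 ?rank_hyperp //=; lia.
exists (fun i => maxrankfun (homog v) (widen_ord rk i)).
set w := fun i => v (maxrankfun (homog v) i).
have /aff_indep_homog ind : row_free (homog w).
  have -> : homog w = rowsub (maxrankfun (homog v)) (homog v); last first.
    exact: maxrowsub_free.
  apply/matrixP => i j; rewrite !mxE; case: splitP => k _; rewrite !mxE //.
move=> c c0 cv i.
(* Only the first [m] rows of a maximal free family are kept; extending [c] by zero reduces to the
   whole family. *)
pose c' (j : 'I_(\rank (homog v))) := if insub (val j) is Some k then c k else 0.
have sumE (V : nmodType) (G : R -> 'I_(\rank (homog v)) -> V) :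
    (forall j, G 0 j = 0) ->
    \sum_j G (c' j) j = \sum_(k < m) G (c k) (widen_ord rk k).
  move=> G0; rewrite (bigID (fun j : 'I__ => (val j < m)%N)) /= [X in _ + X]big1.
    rewrite addr0; under [RHS]eq_bigr => k _.
      have -> : c k = c' (widen_ord rk k) by rewrite /c' /= valK.
    over.
    by rewrite (big_ord_narrow rk).
  by move=> j /negPf jm; rewrite /c' insubF.
have := ind c'.
rewrite (sumE _ (fun s _ => s)) // c0 (sumE _ (fun s j => s *: w j)) ?cv.
  by move=> /(_ erefl erefl (widen_ord rk i)); rewrite /c' /= valK.
by move=> j; rewrite scale0r.
Qed.


(** Serves both dimension counts: [a = 0] gives [k = d] for the polytope, [a != 0] gives [k = d - 1]
    for a facet. *)
Lemma conv_affdim (T : finType) (g : T -> 'rV[R]_d) A a (b : R) k :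
  (forall x, A x -> exists t, x = g t) -> (exists x, A x) ->
  (forall x, A x -> dotv a x = b) -> spans_hyperplane A a ->
  d = (k + (a != 0%R))%N -> has_affdim (conv A) k.
Proof.
move=> Ag [x0 Ax0] Ab span dk.
have [t0 _] := Ag _ Ax0.
have cardT : #|T| = #|T|.-1.+1 by rewrite prednK //; apply/card_gt0P; exists t0.
(* Indices whose point lies outside [A] default to [x0], so the values of [v] are exactly the points
   of [A]. *)
pose v (i : 'I_#|T|.-1.+1) :=
  let x := g (enum_val (cast_ord (esym cardT) i)) in if `[< A x >] then x else x0.
have Av i : A (v i) by rewrite /v; case: asboolP.
have vA x : A x -> exists i, x = v i.
  move=> Ax; have [t xt] := Ag _ Ax.
  exists (cast_ord cardT (enum_rank t)).
  by rewrite /v cast_ordK enum_rankK -xt; case: asboolP.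
split; last first.
  move=> n w cw; have wb i : dotv a (w i) = b by exact: conv_dotv_eq (cw i).
  have [a0|a0] := eqVneq a 0.
    by move=> /aff_indep_size; move: dk; rewrite a0 eqxx addn0 => <-.
  by move=> /(aff_indep_size_hyperp a0 wb); move: dk; rewrite a0 addn1 => <-.
have [|a' b' vb'|f] := @spanning_family_aff_indep _ v a b.
- by move=> i; exact: Ab.
- by apply: (span a' b') => x /vA [i ->].
move: f; have -> : (d.+1 - (a != 0%R))%N = k.+1 by lia.
by move=> f ind; exists (fun i => v (f i)); split=> // i; exact: conv_sub.
Qed.

Lemma has_affdim_unique S k k' : has_affdim S k -> has_affdim S k' -> k = k'.
Proof.
move=> [[v [Sv iv]] uk] [[v' [Sv' iv']] uk'].
by apply/eqP; rewrite eqn_leq; have := uk _ _ Sv' iv'; have := uk' _ _ Sv iv; lia.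
Qed.

(** * Facets as hulls of sets of maximisers *)

Definition argmax A a : rset R d :=
  fun x => A x /\ forall y, A y -> dotv a y <= dotv a x.

Lemma argmaxE A B a (b : R) : (exists x, B x) ->
  (forall x, A x -> dotv a x <= b) ->
  (forall x, B x <-> A x /\ dotv a x = b) -> argmax A a = B.
Proof.
move=> [x0 /[dup] Bx0 +] ub BE; rewrite BE => -[Ax0 bx0].
apply/predeqP => x; rewrite BE; split=> [[Ax mx]|[Ax bx]]; split=> //.
  by apply/eqP; rewrite eq_le ub //= -bx0 mx.
by move=> y Ay; rewrite bx ub.
Qed.

Lemma argmaxZ A a (t : R) : 0 < t -> argmax A (t *: a) = argmax A a.
Proof.
move=> t0; apply/predeqP => x; split=> -[Ax mx]; split=> // y Ay.
  by have := mx y Ay; rewrite !dotvZ ler_pM2l.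
by rewrite !dotvZ ler_pM2l // mx.
Qed.

(* A facet contains d affinely independent points, so the affine functionals
   vanishing on it form a line. *)
Lemma facet_argmax (T : finType) (g : T -> 'rV[R]_d) A F :
  (forall x, A x -> exists t, x = g t) -> (exists x, A x) ->
  spans_hyperplane A 0 -> (0 < d)%N ->
  is_facet (conv A) F <->
  exists a, [/\ a != 0, exists x, argmax A a x, F = conv (argmax A a)
    & spans_hyperplane (argmax A a) a].
Proof.
move=> Ag Ane full d0.
have dimA : has_affdim (conv A) d.
  apply: (conv_affdim Ag Ane _ full) => [x _|]; first exact: dot0v.
  by rewrite eqxx addn0.
split; last first.
  move=> [a [a0 [x Vx] -> span]].
  have eqV : argmax A a = fun y => A y /\ dotv a y = dotv a x.
    case: Vx => Ax mx; by apply: (argmaxE (b := dotv a x)) => //; exists x.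
  split.
    exists a, (dotv a x); case: Vx => _ mx.
    by split; [exact: conv_dotv_le|rewrite conv_face // eqV].
  exists d.-1; rewrite prednK //; split=> //.
  apply: (conv_affdim (g := g) (a := a) (b := dotv a x)) => //.
  - by move=> y [/Ag].
  - by exists x.
  - by rewrite eqV => y [].
  - by rewrite a0 addn1 prednK.
move=> [[a [b [cub FE]]] [k [dimk Fk]]].
have kd : d = k.+1 by exact: has_affdim_unique dimA dimk.
have ub x : A x -> dotv a x <= b by move=> Ax; apply: cub; exact: conv_sub.
have [[v [Fv ind]] _] := Fk.
(* For [a = 0] the face would be all of [conv A], whose dimension is [k.+1] and not [k]. *)
have a0 : a != 0.
  apply/eqP => a0; have : F = conv A.
    rewrite FE; apply/predeqP => x; split=> [[]//|cx]; split=> //.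
    by have := Fv ord0; rewrite FE a0 !dot0v => -[].
  by move=> FA; move: Fk; rewrite FA => /(has_affdim_unique dimk) /eqP; lia.
move: FE; rewrite conv_face // => FE.
have [x [Ax ax]] : exists x, A x /\ dotv a x = b.
  by have := Fv ord0; rewrite FE => /conv_nonempty.
have eqV : argmax A a = fun y => A y /\ dotv a y = b.
  by apply: (argmaxE (b := b)) => //; exists x.
exists a; split=> //; first by exists x; rewrite eqV.
- by rewrite FE eqV.
move=> a' b' Vb'; move: v Fv ind; rewrite -kd => v Fv ind.
apply: (hyperp_unique (b := b) (b' := b') ind) => // i; have := Fv i.
  by rewrite FE; apply: conv_dotv_eq => y [].
by rewrite FE -eqV; exact: conv_dotv_eq.
Qed.

End Polytope.

(** * Auxiliary facts on sums, indices and powers *)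

(** Stated without subtraction so as to serve both exponents in [nat] and values in [R]. *)
Lemma sum_agree_off2 (I : finType) (V : nmodType) (f g : I -> V) (i j : I) :
  i != j -> (forall k, k != i -> k != j -> f k = g k) ->
  \sum_k f k + (g i + g j) = \sum_k g k + (f i + f j).
Proof.
move=> ij fg; rewrite (bigD1 i) // (bigD1 j) 1?eq_sym //=.
rewrite [in RHS](bigD1 i) // [in RHS](bigD1 j) 1?eq_sym //=.
rewrite [in LHS](eq_bigr g); last by move=> k /andP[ki kj]; apply: fg.
set S := \sum_(_ | _) _.
by rewrite [LHS](AC ((1*2)*2) ((4*(5*3))*(1*2))).
Qed.

Lemma ord_avoid2 d (i j : 'I_d) : (3 <= d)%N -> exists k, k != i /\ k != j.
Proof.
move=> d3; have : (0 < #|~: [set i; j]|)%N.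
  by have := cardsC [set i; j]; rewrite cards2 card_ord; case: (i != j); lia.
case/card_gt0P => k; rewrite !inE negb_or => /andP[ki kj].
by exists k.
Qed.

(** Strict Bernoulli inequality; it starts at exponent 2 because exponents 0 and 1 give equality. *)
Lemma bernoulli_lt (R : realFieldType) (x : R) n :
  1 < x -> 1 + (x - 1) * n.+2%:R < x ^+ n.+2.
Proof.
move=> x1; elim: n => [|n IH]; first by rewrite expr2; nra.
rewrite exprS; apply: lt_trans (_ : x * (1 + (x - 1) * n.+2%:R) < _).
  have : 0 < n.+2%:R :> R by rewrite ltr0n.
  rewrite -[n.+3]addn1 natrD; set m := n.+2%:R => m0.
  have : 0 < (x - 1) * (x - 1) * m by rewrite !mulr_gt0 // subr_gt0.
  by lra.
by rewrite ltr_pM2l // (lt_trans ltr01).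
Qed.

(** * The points in terms of exponent vectors of sum [e] *)

Section Compositions.
Variables (R : realType) (p e d : nat).
Hypotheses (p_gt1 : (1 < p)%N) (e_ge2 : (2 <= e)%N) (d_ge3 : (3 <= d)%N).
Implicit Types (a : 'rV[R]_d) (gam : 'I_d -> nat).

Let q : R := p%:R.

Let q_ge2 : 2 <= q.
Proof. by rewrite /q (ler_nat _ 2). Qed.

Let q_gt0 : 0 < q.
Proof. exact: lt_le_trans q_ge2. Qed.

Let q_gt1 : 1 < q.
Proof. by apply: lt_le_trans q_ge2; rewrite ltr1n. Qed.

Let qX_gt0 n : 0 < q ^+ n.
Proof. exact: exprn_gt0. Qed.

Definition pt gam : 'rV[R]_d := \row_j (p ^ gam j)%N%:R.

Definition points : rset R d :=
  fun x => exists gam, (\sum_i gam i)%N = e /\ x = pt gam.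

Definition axis_points : rset R d :=
  fun x => exists i : 'I_d, x = \row_j (if j == i then p ^ e else 1)%N%:R.

Definition coord_points (i : 'I_d) : rset R d := fun x =>
  exists gam, [/\ gam i = 0%N, (\sum_(j < d) gam j)%N = e & x = pt gam].

Definition cube_points (lam : nat) (beta : 'I_d -> nat) : rset R d := fun x =>
  exists eps : 'I_d -> bool,
    (\sum_(j < d) eps j)%N = lam /\ x = \row_j (p ^ (beta j + eps j))%N%:R.

Lemma ptE gam i : pt gam 0 i = q ^+ gam i.
Proof. by rewrite mxE natrX. Qed.

Lemma dotv_pt a gam : dotv a (pt gam) = \sum_i a 0 i * q ^+ gam i.
Proof. by apply: eq_bigr => i _; rewrite ptE. Qed.

Lemma dotv_pt_agree_off2 a gam gam' i j : i != j ->
  (forall k, k != i -> k != j -> gam k = gam' k) ->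
  dotv a (pt gam) + (a 0 i * q ^+ gam' i + a 0 j * q ^+ gam' j) =
  dotv a (pt gam') + (a 0 i * q ^+ gam i + a 0 j * q ^+ gam j).
Proof.
move=> ij agree; rewrite !dotv_pt.
by apply: (sum_agree_off2 ij) => k ki kj; rewrite agree.
Qed.

Definition single (i : 'I_d) (j : 'I_d) : nat := if j == i then e else 0%N.

Lemma sum_single i : (\sum_j single i j)%N = e.
Proof.
rewrite (bigD1 i) //= /single eqxx big1 ?addn0 // => j /negPf ->.
by [].
Qed.

Lemma axis_pointE x : axis_points x <-> exists i, x = pt (single i).
Proof.
by split=> -[i ->]; exists i; apply/rowP => j; rewrite !mxE /single; case: eqP.
Qed.

Lemma leq_comp gam i : (\sum_j gam j)%N = e -> (gam i <= e)%N.
Proof. by move=> <-; rewrite (bigD1 i) //= leq_addr. Qed.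

Lemma points_finite x : points x ->
  exists t : {ffun 'I_d -> 'I_e.+1}, x = pt (fun i => t i : nat).
Proof.
move=> [gam [gam_e ->]]; exists [ffun i => inord (gam i)].
by apply/rowP => j; rewrite !mxE ffunE inordK // ltnS leq_comp.
Qed.

(** * Each of the three families spans a hyperplane *)

(** For [j != i], a third index [l] gives three points with [i]-th exponent 0: all of [e] at [j],
    all at [l], and [e - 1] at [j] with 1 at [l]. Equal values there force [a 0 j = 0]. *)
Lemma spans_coord i : spans_hyperplane (coord_points i) (- delta_mx 0 i).
Proof.
move=> a b ab; exists (- a 0 i).
have a0 j : j != i -> a 0 j = 0.
  move=> ji; have [l [li lj]] := ord_avoid2 i j d_ge3.
  have il : (i == l) = false by rewrite eq_sym; apply/negbTE.
  have ij : (i == j) = false by rewrite eq_sym; apply/negbTE.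
  have jl : j != l by rewrite eq_sym.
  have sj : dotv a (pt (single j)) = b.
    by apply: ab; exists (single j); rewrite sum_single /single ij.
  have sl : dotv a (pt (single l)) = b.
    by apply: ab; exists (single l); rewrite sum_single /single il.
  pose gam k := if k == j then e.-1 else if k == l then 1%N else 0%N.
  have sg : dotv a (pt gam) = b.
    apply: ab; exists gam; split=> //; first by rewrite /gam ij il.
    have : (\sum_k gam k + (single j j + single j l) =
      \sum_k single j k + (gam j + gam l))%N.
      by apply: sum_agree_off2 => // k /negPf kj /negPf kl; rewrite /gam /single kj kl.
    rewrite sum_single /gam /single !eqxx (negPf lj) /=; lia.
  have := @dotv_pt_agree_off2 a (single j) (single l) j l jl.
  have := @dotv_pt_agree_off2 a gam (single j) j l jl.
  rewrite sj sl sg /gam /single !eqxx (negPf lj) (negPf jl).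
  move=> /(_ _)/wrap[|E1]; first by move=> k /negPf -> /negPf ->.
  move=> /(_ _)/wrap[|E2]; first by move=> k /negPf -> /negPf ->.
  have qe : q ^+ e = q * q ^+ e.-1 by rewrite -exprS prednK // ltnW.
  have q1 : 1 < q ^+ e.-1 by rewrite exprn_egt1 //; lia.
  move: E1 E2; rewrite !expr0 !expr1 !mulr1.
  move=> /addrI E1 /addrI E2.
  have /eqP : (a 0 l - a 0 j) * (q ^+ e - 1) = 0 by rewrite mulrBr !mulrBl; lra.
  rewrite mulf_eq0 !subr_eq0 => /orP[/eqP al|/eqP qe1]; last first.
    by have : 1 < q ^+ e; [rewrite exprn_egt1 //; lia|rewrite qe1 ltxx].
  (* With [a 0 l = a 0 j], the factorisation is that of [q^e + 1 - q^(e-1) - q]; the middle factor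
     is nonzero since [e >= 2]. *)
  have /eqP : a 0 j * (q ^+ e.-1 - 1) * (q - 1) = 0.
    by move: E1; rewrite al qe; lra.
  have q1' : q - 1 != 0 by rewrite subr_eq0 gt_eqF.
  have q2' : q ^+ e.-1 - 1 != 0 by rewrite subr_eq0 gt_eqF.
  by rewrite !mulf_eq0 (negPf q1') (negPf q2') !orbF => /eqP.
apply/rowP => j; rewrite !mxE eqxx /=; case: eqP => [->|/eqP ji].
  by rewrite mulrNN mulr1.
by rewrite a0 // oppr0 mulr0.
Qed.

Lemma points_full : spans_hyperplane points 0.
Proof.
move=> a b ab; exists 0; rewrite scaler0; apply/rowP => j; rewrite mxE.
have [i [ij _]] := ord_avoid2 j j d_ge3.
have [|t ->] := @spans_coord i a b.
  by move=> x [gam [_ gam_e ->]]; apply: ab; exists gam.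
by rewrite !mxE eqxx (eq_sym j) (negPf ij) oppr0 mulr0.
Qed.

Lemma spans_axis : spans_hyperplane axis_points (const_mx 1).
Proof.
move=> a b ab; pose i0 : 'I_d := Ordinal (ltn_trans (isT : 0 < 2)%N d_ge3).
exists (a 0 i0); apply/rowP => i; rewrite !mxE mulr1.
have [->//|ii0] := eqVneq i i0.
have sb k : dotv a (pt (single k)) = b by apply: ab; apply/axis_pointE; exists k.
have := @dotv_pt_agree_off2 a (single i) (single i0) i i0 ii0.
rewrite !sb /single !eqxx (negPf ii0) (eq_sym i0) (negPf ii0) => /(_ _)/wrap[|].
  by move=> k /negPf -> /negPf ->.
rewrite !expr0 !mulr1 => /addrI E.
have q1 : 1 < q ^+ e by rewrite exprn_egt1 //; lia.
have /eqP : (a 0 i - a 0 i0) * (q ^+ e - 1) = 0 by rewrite mulrBr !mulrBl; lra.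
by rewrite mulf_eq0 !subr_eq0 => /orP[/eqP//|/eqP ?]; exfalso; lra.
Qed.

Lemma subset_between (i j : 'I_d) (lam : nat) : i != j -> (1 <= lam <= d.-1)%N ->
  exists s : seq 'I_d, [/\ uniq s, size s = lam.-1, i \notin s & j \notin s].
Proof.
move=> ij lamd; have : (lam.-1 <= #|~: [set i; j]|)%N.
  by have := cardsC [set i; j]; rewrite cards2 ij card_ord; lia.
case/card_geqP => s [us ss sub]; exists s; split=> //.
  by apply/negP => /sub; rewrite !inE eqxx.
by apply/negP => /sub; rewrite !inE eqxx orbT.
Qed.

Lemma sum_mem_seq (s : seq 'I_d) : uniq s -> (\sum_(k < d) (k \in s))%N = size s.
Proof. by move=> /card_uniqP <-; rewrite -sum1_card [RHS]big_mkcond. Qed.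

(** Provides two points of the family that differ only at [i] and [j]; the bounds on [lam] let
    [lam - 1] other indices be chosen among [d - 2]. *)
Lemma cube_points_swap (i j : 'I_d) (lam : nat) (beta : 'I_d -> nat) :
  i != j -> (1 <= lam <= d.-1)%N ->
  exists s : seq 'I_d, [/\ i \notin s, j \notin s &
    forall k, k \in [:: i; j] ->
      cube_points lam beta (pt (fun l => (beta l + (l \in k :: s))%N))].
Proof.
move=> ij /[dup] lamd /(subset_between ij) [s [us ss is_ js]].
exists s; split=> // k kij; exists (fun l => l \in k :: s); split=> //.
rewrite sum_mem_seq /= ?ss; first by lia.
by rewrite us andbT; move: kij; rewrite !inE => /orP[] /eqP ->.
Qed.

Lemma spans_cube (lam : nat) (beta : 'I_d -> nat) : (1 <= lam <= d.-1)%N ->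
  spans_hyperplane (cube_points lam beta) (\row_i - q ^- beta i).
Proof.
move=> lamd a b ab; pose i0 : 'I_d := Ordinal (ltn_trans (isT : 0 < 2)%N d_ge3).
exists (- (a 0 i0 * q ^+ beta i0)); apply/rowP => i; rewrite !mxE mulrNN.
suff -> : a 0 i0 * q ^+ beta i0 = a 0 i * q ^+ beta i.
  by rewrite mulfK // gt_eqF.
have [->//|ii0] := eqVneq i i0.
have [s [is_ i0s cube]] := cube_points_swap beta ii0 lamd.
have := @dotv_pt_agree_off2 a (fun l => (beta l + (l \in i :: s))%N)
  (fun l => (beta l + (l \in i0 :: s))%N) i i0 ii0.
rewrite !ab; [|by apply: cube; rewrite !inE eqxx ?orbT..].
rewrite !inE !eqxx (negPf is_) (negPf i0s) (negPf ii0) (eq_sym i0) (negPf ii0) /=.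
move=> /(_ _)/wrap[|]; first by move=> k /negPf ki /negPf ki0; rewrite !inE ki ki0.
rewrite !addn0 !addn1 !exprS => /addrI E.
have /eqP : (a 0 i0 * q ^+ beta i0 - a 0 i * q ^+ beta i) * (q - 1) = 0 by lra.
rewrite mulf_eq0 !subr_eq0 => /orP[/eqP//|/eqP q1].
by move: q_gt1; rewrite q1 ltxx.
Qed.


(** * Maximisers of the coordinate and cube functionals *)

Lemma argmax_coord i : argmax points (- delta_mx 0 i) = coord_points i.
Proof.
have val gam : dotv (- delta_mx 0 i) (pt gam) = - q ^+ gam i.
  by rewrite -scaleN1r dotvZ dotv_delta ptE mulN1r.
have [j [ij _]] := ord_avoid2 i i d_ge3.
apply: (argmaxE (b := -1)).
- exists (pt (single j)), (single j).
  by rewrite sum_single /single eq_sym (negPf ij).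
- by move=> x [gam [_ ->]]; rewrite val lerN2 exprn_ege1 // ltW.
move=> x; split=> [[gam [gi gam_e ->]]|[[gam [gam_e ->]]]].
  by split; [exists gam|rewrite val gi].
rewrite val => /oppr_inj/eqP; case E: (gam i) => [|n]; first by exists gam.
by rewrite gt_eqF // exprn_egt1.
Qed.

(* Convexity of t |-> q^t, compared with its chord through t = 0 and t = 1. *)
Lemma chord_leif (g b : nat) :
  1 + (q - 1) * (g%:R - b%:R) <= q ^- b * q ^+ g ?= iff (g == b) || (g == b.+1).
Proof.
have [gb|bg] := ltnP g b.
  have -> : (g == b) || (g == b.+1) = false by lia.
  apply/leifP.
  have q0 : 0 < q ^- b * q ^+ g by rewrite mulr_gt0 // invr_gt0.
  have gb1 : g%:R + 1 <= b%:R :> R by rewrite natr1 ler_nat.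
  (* For [g < b] the chord is at most [1 - (q - 1)], which is nonpositive because [q >= 2]. *)
  by apply: le_lt_trans q0; have := q_ge2; nra.
rewrite -(subnKC bg); set n := (g - b)%N.
rewrite natrD [b%:R + _]addrC addrK exprD mulKf; last by rewrite gt_eqF.
have -> : (b + n == b) || (b + n == b.+1)%N = ((n == 0) || (n == 1))%N by lia.
case: n => [|[|n]]; apply/leifP => /=; first by rewrite mulr0 addr0 expr0.
  by rewrite mulr1 addrC subrK expr1.
exact: bernoulli_lt.
Qed.

Lemma cube_pointE (lam : nat) (beta : 'I_d -> nat) x :
  (\sum_i beta i + lam)%N = e ->
  cube_points lam beta x <-> exists gam, [/\ (\sum_i gam i)%N = e, x = pt gam &
    forall i, (gam i == beta i) || (gam i == (beta i).+1)].
Proof.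
move=> be; split=> [[eps [eps_lam ->]]|[gam [gam_e -> gb]]].
  exists (fun i => beta i + eps i)%N; split=> //.
    by rewrite big_split /= eps_lam.
  by move=> i; case: (eps i); rewrite ?addn0 ?addn1 eqxx ?orbT.
have gE i : gam i = (beta i + (gam i == (beta i).+1))%N by have := gb i; lia.
exists (fun i => gam i == (beta i).+1); split.
  have := gam_e; under eq_bigr => i _ do rewrite gE.
  by rewrite big_split /= -[in RHS]be; apply: addnI.
by apply/rowP => i; rewrite !mxE [in LHS]gE.
Qed.

(** Sum of the chord bounds over all coordinates: the linear terms add up to [(q - 1) * lam] for
    every [gam] of sum [e], and equality holds only if it holds in each coordinate. *)
Lemma dotv_cube_leif (lam : nat) (beta : 'I_d -> nat) gam :
  (\sum_i beta i + lam)%N = e -> (\sum_i gam i)%N = e ->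
  dotv (\row_i - q ^- beta i) (pt gam) <= - (d%:R + (q - 1) * lam%:R)
    ?= iff [forall i, (gam i == beta i) || (gam i == (beta i).+1)].
Proof.
move=> be ge.
have -> : dotv (\row_i - q ^- beta i) (pt gam) = - \sum_i q ^- beta i * q ^+ gam i.
  by rewrite dotv_pt -sumrN; apply: eq_bigr => i _; rewrite mxE mulNr.
have -> : d%:R + (q - 1) * lam%:R =
    \sum_(i < d) (1 + (q - 1) * ((gam i)%:R - (beta i)%:R)).
  rewrite big_split /= sumr_const card_ord -mulr_sumr sumrB -!natr_sum ge -be.
  by rewrite natrD [_ + lam%:R]addrC addrK.
have := leif_sum (fun i (_ : true) => chord_leif (gam i) (beta i)).
by move=> [le eq]; split; rewrite ?lerN2 // eqr_opp eq_sym.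
Qed.

Lemma argmax_cube (lam : nat) (beta : 'I_d -> nat) :
  (1 <= lam <= d.-1)%N -> (\sum_i beta i + lam)%N = e ->
  argmax points (\row_i - q ^- beta i) = cube_points lam beta.
Proof.
move=> lamd be; apply: (argmaxE (b := - (d%:R + (q - 1) * lam%:R))).
- pose i0 : 'I_d := Ordinal (ltn_trans (isT : 0 < 2)%N d_ge3).
  have [j [ij _]] := ord_avoid2 i0 i0 d_ge3.
  have [s [_ _ cube]] := cube_points_swap beta ij lamd.
  by eexists; apply: (cube j); rewrite inE eqxx.
- by move=> x [gam [ge ->]]; rewrite dotv_cube_leif.
move=> x; rewrite (cube_pointE x be); split=> [[gam [ge -> gb]]|[[gam [ge ->]]]].
  split; first by exists gam.
  by apply/eqP; rewrite (dotv_cube_leif be ge); apply/forallP.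
by move/eqP; rewrite (dotv_cube_leif be ge) => /forallP gb; exists gam.
Qed.

(** * Maximising exponent vectors and the exchange argument *)

Definition optimal a gam : Prop := (\sum_i gam i)%N = e /\
  forall gam', (\sum_i gam' i)%N = e -> dotv a (pt gam') <= dotv a (pt gam).

Lemma argmax_pointsE a x :
  argmax points a x <-> exists gam, optimal a gam /\ x = pt gam.
Proof.
split=> [[[gam [ge ->]] mx]|[gam [[ge mx] ->]]].
  by exists gam; split=> //; split=> // gam' ge'; apply: mx; exists gam'.
by split; [exists gam|move=> y [gam' [ge' ->]]; apply: mx].
Qed.

Lemma optimal_exists a : exists gam, optimal a gam.
Proof.
pose i0 : 'I_d := Ordinal (ltn_trans (isT : 0 < 2)%N d_ge3).
pose Q (t : {ffun 'I_d -> 'I_e.+1}) := (\sum_i t i)%N == e.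
have Qpt gam : (\sum_i gam i)%N = e ->
    exists2 t, Q t & pt gam = pt (fun i => t i : nat).
  move=> ge; have gt i : (inord (gam i) : 'I_e.+1) = gam i :> nat.
    by rewrite inordK // ltnS leq_comp.
  exists [ffun i => inord (gam i)].
    by apply/eqP; rewrite -[RHS]ge; apply: eq_bigr => i _; rewrite ffunE gt.
  by apply/rowP => i; rewrite !mxE ffunE gt.
have [t0 Qt0 _] := Qpt _ (sum_single i0).
case: (arg_maxP (fun t : {ffun 'I_d -> 'I_e.+1} => dotv a (pt (fun i => t i))) Qt0).
move=> t /eqP te mx; exists (fun i => t i : nat); split=> // gam' /Qpt[t' Qt' ->].
exact: mx.
Qed.

(* Compare [gam] with the point where one unit moved from [j] to [i]. *)
Lemma exchange a gam i j : optimal a gam -> i != j -> (0 < gam j)%N ->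
  a 0 i * q ^+ gam i <= a 0 j * q ^+ (gam j).-1.
Proof.
move=> [ge mx] ij gj.
pose gam' k := if k == i then (gam i).+1 else if k == j then (gam j).-1 else gam k.
have ji : (j == i) = false by rewrite eq_sym; apply/negbTE.
have agree k : k != i -> k != j -> gam' k = gam k.
  by move=> /negPf ki /negPf kj; rewrite /gam' ki kj.
have ge' : (\sum_k gam' k)%N = e.
  have : (\sum_k gam' k + (gam i + gam j) = \sum_k gam k + (gam' i + gam' j))%N.
    exact: sum_agree_off2.
  by rewrite ge /gam' !eqxx ji; lia.
have := mx _ ge'; have := @dotv_pt_agree_off2 a gam' gam i j ij agree.
rewrite /gam' !eqxx ji -/gam'.
have -> : q ^+ gam j = q * q ^+ (gam j).-1 by rewrite -exprS prednK.
rewrite exprS; set x := q ^+ gam i; set y := q ^+ _ => E le.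
have : (q - 1) * (a 0 i * x) <= (q - 1) * (a 0 j * y) by lra.
by rewrite ler_pM2l // subr_gt0.
Qed.

(** If [gam i] and [gam j] were both positive, exchanging in both directions would make each of
    [a_i q^gam_i] and [a_j q^gam_j] smaller than the other. *)
Lemma optimal_single a gam : (forall i, 0 < a 0 i) -> optimal a gam ->
  exists i, gam =1 single i.
Proof.
move=> pos opt; have [ge _] := opt.
have [i gi] : exists i, (0 < gam i)%N.
  apply: contrapT => no; move: ge; rewrite big1; first by lia.
  by move=> i _; apply/eqP; rewrite -leqn0 leqNgt; apply/negP => gi; apply: no; exists i.
have g0 j : j != i -> gam j = 0%N.
  move=> ji; case: (posnP (gam j)) => // gj; exfalso.
  have := exchange opt ji gi; rewrite eq_sym in ji.
  have := exchange opt ji gj.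
  have lt k : (0 < gam k)%N -> a 0 k * q ^+ (gam k).-1 < a 0 k * q ^+ gam k.
    by move=> gk; rewrite ltr_pM2l // ltr_eXn2l // prednK.
  by have := lt i gi; have := lt j gj; lra.
exists i => j; rewrite /single; case: eqP => [->|/eqP/g0//].
by rewrite -ge (bigD1 i) //= big1 ?addn0 // => k /g0.
Qed.

Lemma dotv_axis x : axis_points x -> dotv (const_mx 1) x = q ^+ e + d.-1%:R.
Proof.
case/axis_pointE => i ->; rewrite dotv_pt (bigD1 i) //= mxE mul1r /single eqxx.
congr +%R; rewrite (eq_bigr (fun=> 1)); last first.
  by move=> j /negPf ->; rewrite mxE mulr1.
by rewrite sumr_const cardC1 card_ord.
Qed.

Lemma argmax_axis_sub a : (forall i, 0 < a 0 i) ->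
  forall x, argmax points a x -> axis_points x.
Proof.
move=> pos x /argmax_pointsE [gam [/(optimal_single pos) [i gi] ->]].
apply/axis_pointE; exists i; by apply/rowP => j; rewrite !mxE gi.
Qed.

(** Some maximiser exists and is an axis point; all axis points have the same value, so all are
    maximisers. *)
Lemma argmax_axis : argmax points (const_mx 1) = axis_points.
Proof.
have sub := argmax_axis_sub (a := const_mx 1).
have {}sub x : argmax points (const_mx 1) x -> axis_points x.
  by apply: sub => i; rewrite mxE.
have [gam opt] := optimal_exists (const_mx 1).
have mgam : argmax points (const_mx 1) (pt gam) by apply/argmax_pointsE; exists gam.
apply/predeqP => x; split=> [/sub//|Bx]; split.
  by case/axis_pointE: Bx => i ->; exists (single i); rewrite sum_single.
by case: mgam (mgam) => _ mx /sub Bg y /mx; rewrite (dotv_axis Bg) (dotv_axis Bx).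
Qed.

(** * Classification of the facet functionals by sign pattern *)

(** Spanning makes [s] a multiple of [a], and the sign condition at [i] makes the factor
    positive. *)
Lemma argmax_proportional a s (c : R) i :
  spans_hyperplane (argmax points a) a ->
  (forall x, argmax points a x -> dotv s x = c) -> 0 < s 0 i * a 0 i ->
  argmax points a = argmax points s.
Proof.
move=> span /span [t ->]; rewrite mxE -mulrA => ta.
rewrite argmaxZ // ltNge; apply/negP => t0; move: ta; rewrite ltNge => /negP[].
by rewrite mulr_le0_ge0 // -expr2 sqr_ge0.
Qed.

(** Otherwise the [i]-th coordinate functional would be a multiple of [a], and [a 0 j != 0] would
    make the factor zero. *)
Lemma coordinate_not_constant a i j (c : nat) :
  spans_hyperplane (argmax points a) a -> i != j -> a 0 j != 0 ->
  ~ (forall gam, optimal a gam -> gam i = c).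
Proof.
move=> span ij aj const.
have [|t dt] := span (delta_mx 0 i) (q ^+ c).
  move=> x /argmax_pointsE [gam [opt ->]].
  by rewrite dotv_delta ptE const.
move/rowP: (dt) => /(_ j) /esym/eqP; rewrite !mxE [j == i]eq_sym (negPf ij) andbF.
rewrite mulf_eq0 (negPf aj) orbF => /eqP t0.
by move/rowP: dt => /(_ i) /eqP; rewrite !mxE !eqxx t0 mul0r oner_eq0.
Qed.

(** If [gam j >= gam' j + 2], equal sums give [i] with [gam i < gam' i]. Exchanges in opposite
    directions then give the cycle [a_i q^gam_i <= a_j q^(gam_j - 1) < a_j q^gam'_j <= a_i q^(gam'_i
    - 1) <= a_i q^gam_i]. *)
Lemma optimal_close a gam gam' j : (forall i, a 0 i < 0) ->
  optimal a gam -> optimal a gam' -> (gam j <= (gam' j).+1)%N.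
Proof.
move=> neg opt opt'; rewrite leqNgt; apply/negP => gj.
have [i gi] : exists i, (gam i < gam' i)%N.
  apply: contrapT => no; have ge i : (gam' i <= gam i)%N.
    by rewrite leqNgt; apply/negP => gi; apply: no; exists i.
  have [] := opt; have [] := opt'; rewrite (bigD1 j) //= => E' _.
  rewrite (bigD1 j) //= => E _.
  have : (\sum_(i < d | i != j) gam' i <= \sum_(i < d | i != j) gam i)%N by exact: leq_sum.
  by move=> /(leq_add (ltnW gj)); rewrite E -E' addSn ltnn.
have ij : i != j by apply/eqP => ij; move: gi gj; rewrite ij; lia.
have ji : j != i by rewrite eq_sym.
have gj0 : (0 < gam j)%N by lia.
have gi0 : (0 < gam' i)%N by lia.
have E1 := exchange opt ij gj0.
have E2 := exchange opt' ji gi0.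
have E3 : a 0 i * q ^+ (gam' i).-1 <= a 0 i * q ^+ gam i.
  by rewrite ler_nM2l // ler_eXn2l //; lia.
have E4 : a 0 j * q ^+ (gam j).-1 < a 0 j * q ^+ gam' j.
  by rewrite ltr_nM2l // ltr_eXn2l //; lia.
by lra.
Qed.

Lemma optimal_in_cube a : (forall i, a 0 i < 0) -> exists beta : 'I_d -> nat,
  forall gam, optimal a gam -> forall i, (gam i == beta i) || (gam i == (beta i).+1).
Proof.
move=> neg; have [gam0 opt0] := optimal_exists a.
suff /fin_all_exists [beta betaP] : forall i, exists b : nat,
    forall gam, optimal a gam -> (gam i == b) || (gam i == b.+1).
  by exists beta => gam opt i; exact: betaP.
(* The witness is the least [i]-th exponent of a maximiser: [gam0 i], or [gam1 i] if some [gam1]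
   goes lower. *)
move=> i; have [[gam1 [opt1 lt]]|no] :=
    pselect (exists gam, optimal a gam /\ (gam i < gam0 i)%N).
  exists (gam1 i) => gam opt; have := optimal_close i neg opt opt1.
  by have := optimal_close i neg opt0 opt; lia.
exists (gam0 i) => gam opt; have := optimal_close i neg opt opt0.
have : ~~ (gam i < gam0 i)%N by apply/negP => lt; apply: no; exists gam.
by lia.
Qed.

Lemma argmax_negative a : (forall i, a 0 i < 0) ->
  spans_hyperplane (argmax points a) a ->
  exists (lam : nat) (beta : 'I_d -> nat), [/\ (1 <= lam <= minn e d.-1)%N,
    (\sum_i beta i + lam)%N = e & argmax points a = cube_points lam beta].
Proof.
move=> neg span; have [beta inb] := optimal_in_cube neg.
pose i0 : 'I_d := Ordinal (ltn_trans (isT : 0 < 2)%N d_ge3).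
have [i1 [i10 _]] := ord_avoid2 i0 i0 d_ge3; rewrite eq_sym in i10.
have a1 : a 0 i1 != 0 by rewrite lt_eqF.
have gE gam : optimal a gam -> forall i, gam i = (beta i + (gam i == (beta i).+1))%N.
  by move=> opt i; case/orP: (inb _ opt i) => /eqP ->; rewrite ?eqxx; lia.
have sumE gam : optimal a gam ->
    (\sum_i beta i + \sum_i (gam i == (beta i).+1))%N = e.
  move=> opt; have [<- _] := opt; rewrite -big_split /=.
  by apply: eq_bigr => i _; rewrite -gE.
have [gam0 opt0] := optimal_exists a.
(* For every maximiser, [lam] counts the coordinates with [gam i = beta i + 1]; [sumE] shows that
   the subtraction does not truncate. *)
pose lam := (e - \sum_i beta i)%N.
have be : (\sum_i beta i + lam)%N = e by have := sumE _ opt0; rewrite /lam; lia.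
have epsE gam : optimal a gam -> (\sum_i (gam i == (beta i).+1))%N = lam.
  by move=> /sumE; rewrite /lam; lia.
(* If [lam = 0], every maximiser equals [beta] at [i0]; if [lam >= d], every maximiser equals
   [beta + 1] there. Both contradict [coordinate_not_constant]. *)
have lam0 : (0 < lam)%N.
  rewrite lt0n; apply/eqP => l0.
  apply: (coordinate_not_constant (c := beta i0) span i10 a1) => gam opt.
  have /eqP := epsE _ opt; rewrite l0 sum_nat_eq0 => /forallP/(_ i0).
  by rewrite gE //; case: eqP; lia.
have lamd : (lam < d)%N.
  rewrite ltnNge; apply/negP => dl.
  apply: (coordinate_not_constant (c := (beta i0).+1) span i10 a1) => gam opt.
  apply/eqP; case E: (gam i0 == _) => //; exfalso.
  have := epsE _ opt; rewrite (bigD1 i0) //= E add0n => el.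
  have : (\sum_(i < d | i != i0) (gam i == (beta i).+1) <= \sum_(i < d | i != i0) 1)%N.
    by apply: leq_sum => i _; case: (_ == _).
  by rewrite el sum1_card cardC1 card_ord; lia.
have lamd' : (1 <= lam <= d.-1)%N by lia.
exists lam, beta; split=> //; first by have := be; lia.
rewrite -(argmax_cube lamd' be).
apply: (argmax_proportional (i := i0) (c := - (d%:R + (q - 1) * lam%:R)) span).
  move=> x /argmax_pointsE [gam [opt ->]]; have [ge _] := opt.
  by apply/eqP; rewrite (dotv_cube_leif be ge); apply/forallP; exact: inb.
by rewrite mxE nmulr_rgt0 // oppr_lt0 invr_gt0.
Qed.

Lemma argmax_classification a : a != 0 ->
  spans_hyperplane (argmax points a) a ->
  [\/ argmax points a = axis_points,
      exists i, argmax points a = coord_points i |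
      exists (lam : nat) (beta : 'I_d -> nat), [/\ (1 <= lam <= minn e d.-1)%N,
        (\sum_i beta i + lam)%N = e & argmax points a = cube_points lam beta]].
Proof.
move=> a0 span.
pose i0 : 'I_d := Ordinal (ltn_trans (isT : 0 < 2)%N d_ge3).
have [/forallP pos|/forallPn [j]] := boolP [forall i, 0 < a 0 i].
  constructor 1; rewrite -argmax_axis.
  apply: (argmax_proportional (i := i0) (c := q ^+ e + d.-1%:R) span).
    by move=> x /(argmax_axis_sub pos); exact: dotv_axis.
  by rewrite mxE mul1r.
rewrite -leNgt => aj.
(* Moving a unit from [k] to [i] bounds a nonnegative number by a nonpositive one, so both vanish
   and [a 0 i = a 0 k = 0]. *)
have vanish i k : i != k -> a 0 k <= 0 <= a 0 i -> a 0 k < a 0 i ->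
    forall gam, optimal a gam -> gam k = 0%N.
  move=> ik /andP[ak ai] aki gam opt; case: (posnP (gam k)) => // gk.
  have := exchange opt ik gk.
  have : a 0 k * q ^+ (gam k).-1 <= 0 by rewrite pmulr_lle0.
  have : 0 <= a 0 i * q ^+ gam i by rewrite pmulr_lge0.
  move=> x0 y0 xy; have /eqP : a 0 k * q ^+ (gam k).-1 = 0 by lra.
  have /eqP : a 0 i * q ^+ gam i = 0 by lra.
  rewrite !mulf_eq0 !expf_eq0 (gt_eqF q_gt0) !andbF !orbF => /eqP ei /eqP ek.
  by move: aki; rewrite ei ek ltxx.
have [/existsP [i ai]|/existsPn npos] := boolP [exists i, 0 < a 0 i].
  have ij : i != j by apply/eqP => ij; move: ai; rewrite ij ltNge aj.
  exfalso; apply: (coordinate_not_constant (i := j) (j := i) (c := 0%N) span).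
  - by rewrite eq_sym.
  - by rewrite gt_eqF.
  - by apply: vanish ij _ _; [rewrite aj ltW|exact: le_lt_trans ai].
have {}npos i : a 0 i <= 0 by rewrite leNgt.
have [/existsP [k /eqP ak]|/existsPn nz] := boolP [exists k, a 0 k == 0].
  have [i ai] : exists i, a 0 i != 0.
    apply: contrapT => no; case/eqP: a0; apply/rowP => i; rewrite mxE.
    by apply/eqP/negPn/negP => ai; apply: no; exists i.
  have {}ai : a 0 i < 0 by rewrite lt_neqAle ai npos.
  have ki : k != i by apply/eqP => ki; move: ai; rewrite -ki ak ltxx.
  constructor 2; exists i; rewrite -argmax_coord.
  apply: (argmax_proportional (i := i) (c := -1) span).
    move=> x /argmax_pointsE [gam [opt ->]].
    have gi : gam i = 0%N by apply: (vanish k i); rewrite ?ak ?lexx ?andbT ?npos.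
    by rewrite -scaleN1r dotvZ dotv_delta ptE gi mulr1.
  by rewrite !mxE !eqxx mulN1r oppr_gt0.
constructor 3; apply: argmax_negative span => i.
by rewrite lt_neqAle nz npos.
Qed.

Lemma facet_classification (F : rset R d) : is_facet (conv points) F <->
  [\/ F = conv axis_points,
      exists i, F = conv (coord_points i) |
      exists (lam : nat) (beta : 'I_d -> nat), [/\ (1 <= lam <= minn e d.-1)%N,
        (\sum_i beta i + lam)%N = e & F = conv (cube_points lam beta)]].
Proof.
pose i0 : 'I_d := Ordinal (ltn_trans (isT : 0 < 2)%N d_ge3).
have ne : exists x, points x.
  by exists (pt (single i0)), (single i0); rewrite sum_single.
rewrite (facet_argmax F points_finite ne points_full _); last by lia.
have argmax_ne a : exists x, argmax points a x.
  have [gam opt] := optimal_exists a.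
  by exists (pt gam); apply/argmax_pointsE; exists gam.
split=> [[a [a0 _ -> /(argmax_classification a0)]]|].
  case=> [->|[i ->]|[lam [beta [lame be ->]]]]; [constructor 1|constructor 2|constructor 3] => //.
    by exists i.
  by exists lam, beta.
case=> [->|[i ->]|[lam [beta [lame be ->]]]].
- exists (const_mx 1); rewrite argmax_axis; split=> //.
  + by apply/eqP => /rowP/(_ i0)/eqP; rewrite !mxE oner_eq0.
  + by rewrite -argmax_axis.
  + exact: spans_axis.
- exists (- delta_mx 0 i); rewrite argmax_coord; split=> //.
  + by apply/eqP => /rowP/(_ i)/eqP; rewrite !mxE !eqxx oppr_eq0 oner_eq0.
  + by rewrite -argmax_coord.
  + exact: spans_coord.
- have lamd : (1 <= lam <= d.-1)%N by move: lame; rewrite leq_min; lia.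
  exists (\row_i - q ^- beta i); rewrite (argmax_cube lamd be); split=> //.
  + apply/eqP => /rowP/(_ i0)/eqP; rewrite !mxE oppr_eq0 invr_eq0 expf_eq0.
    by rewrite (gt_eqF q_gt0) andbF.
  + by rewrite -(argmax_cube lamd be).
  + exact: spans_cube.
Qed.

End Compositions.

(** * From vector-factorisations to exponent vectors *)

Lemma vfact_prime_power (R : realType) (p e d : nat) : prime p ->
  @vfact R d (p ^ e) = @points R p e d.
Proof.
move=> pp; apply/predeqP => x; split=> [[v [ve ->]]|[gam [ge ->]]].
  have /fin_all_exists [gam vE] : forall i, exists g, v i = (p ^ g)%N.
    move=> i; have : (v i %| p ^ e)%N by rewrite -ve (bigD1 i) //= dvdn_mulr.
    by case/(dvdn_pfactor _ _ pp) => g _ ->; exists g.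
  exists gam; split; last by apply/rowP => i; rewrite !mxE vE.
  apply/eqP; rewrite -(eqn_exp2l _ _ (prime_gt1 pp)) expn_sum -ve.
  by apply/eqP; apply: eq_bigr => i _.
by exists (fun i => p ^ gam i)%N; split=> //; rewrite -expn_sum ge.
Qed.

Theorem theorem1p2 (R : realType) (p e d : nat) :
  prime p -> (2 <= e)%N -> (3 <= d)%N ->
  forall F : rset R d,
    is_facet (conv (@vfact R d (p ^ e))) F <->
    [\/ F = conv (fun x : 'rV[R]_d =>
                   exists i : 'I_d, x = \row_j (if j == i then p ^ e else 1)%N%:R),
        (exists i : 'I_d,
           F = conv (fun x : 'rV[R]_d =>
                 exists beta : 'I_d -> nat,
                   [/\ beta i = 0%N, (\sum_(j < d) beta j)%N = e &
                       x = \row_j (p ^ beta j)%N%:R]))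
      | (exists (lam : nat) (beta : 'I_d -> nat),
           [/\ (1 <= lam <= minn e d.-1)%N,
               (\prod_(j < d) p ^ beta j)%N = (p ^ (e - lam))%N &
               F = conv (fun x : 'rV[R]_d =>
                 exists eps : 'I_d -> bool,
                   (\sum_(j < d) eps j)%N = lam /\
                   x = \row_j (p ^ (beta j + eps j))%N%:R)])].
Proof.
move=> pp e2 d3 F; rewrite vfact_prime_power //.
have p1 := prime_gt1 pp.
rewrite (facet_classification p1 e2 d3 F).
(* The bound [lam <= e] keeps [e - lam] from truncating, so the product and sum conditions agree. *)
have prodE lam (beta : 'I_d -> nat) : (1 <= lam <= minn e d.-1)%N ->
    (\prod_(j < d) p ^ beta j)%N = (p ^ (e - lam))%N <->
    (\sum_i beta i + lam)%N = e.
  rewrite leq_min -expn_sum => lame; split=> [/eqP|be]; last by congr expn; lia.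
  by rewrite eqn_exp2l // => /eqP ->; lia.
split=> -[FE|[i FE]|[lam [beta [lame be FE]]]].
- by constructor 1.
- by constructor 2; exists i.
- by constructor 3; exists lam, beta; split=> //; apply/prodE.
- by constructor 1.
- by constructor 2; exists i.
- by constructor 3; exists lam, beta; split=> //; apply/prodE.
Qed.
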